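(* Assume the setup below. Let $\boldsymbol{\lambda},\boldsymbol{\mu}\in\mathcal{P}(l,n)$. Then $\tau_{\mathbf{r}}(w(\boldsymbol{\lambda}))_J=\tau_{\mathbf{r}}(w(\boldsymbol{\mu}))_J$ if and only if $$\sum_{i=0}^{l-1}x^{\overline{m}_i}\,\mathrm{Res}_{\lambda^{(i)}}(x^d)=\sum_{i=0}^{l-1}x^{\overline{m}_i}\,\mathrm{Res}_{\mu^{(i)}}(x^d)\quad\text{in }\mathbb{Z}[x,x^{-1}],$$ where $\overline{m}_i=d(H_1+\dots+H_i)$ (so $\overline{m}_0=0$) and $\mathrm{Res}_\nu(x)=\sum_{(a,b)\in Y(\nu)}x^{b-a}$.
   Context: Fix positive integers $l,n$. A partition $\lambda=(\lambda_1\ge\lambda_2\ge\dots)$ has $\lambda_i=0$ for large $i$; its Young diagram is $Y(\lambda)=\{(a,b)\in\mathbb{Z}^2:a\ge1,\,1\le b\le\lambda_a\}$ and the content of a node $(a,b)$ is $b-a$. An $l$-multipartition of $n$ is an $l$-tuple $\boldsymbol{\lambda}=(\lambda^{(0)},\dots,\lambda^{(l-1)})$ of partitions with $\sum|\lambda^{(i)}|=n$; $\mathcal{P}(l,n)$ is their set. For $r\in\mathbb{Z}$ the $r$-shifted $\beta$-number of $\lambda$ is the strictly decreasing sequence $\beta^r(\lambda)=(\lambda_i+r+1-i)_{i\ge1}$, and $\beta(\lambda)=\beta^0(\lambda)$. A strictly decreasing integer sequence $C=(C_1,C_2,\dots)$ stabilises with respect to $r$ if $C_i=r+1-i$ for all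 large $i$; every such $C$ equals $\beta^r(\lambda)$ for a unique partition $\lambda$. For an $l$-tuple $\mathbf{C}=(C^0,\dots,C^{l-1})$ of strictly decreasing integer sequences, $\chi(\mathbf{C})=\{l(C^q_i-1)+q+1:0\le q\le l-1,\ i\ge1\}$. A node of $Y(\lambda)$ is removable if deleting it leaves the Young diagram of a partition; for $J\subseteq\{0,\dots,l-1\}$ it is $J$-removable if it is removable and its content is congruent mod $l$ to some $j\in J$. The $J$-heart $\lambda_J$ is the partition obtained from $\lambda$ by removing $J$-removable nodes as long as possible. Parameters: $H_1,\dots,H_{l-1}\in\mathbb{Q}$, $H_0=-(H_1+\dots+H_{l-1})$, and $d$ a positive integer with $dH_i\in\mathbb{Z}$ for all $i$. Put $\theta=(1+H_0,H_1,\dots,H_{l-1})\in\mathbb{Q}^l_1:=\{(\theta_0,\dots,\theta_{l-1})\in\mathbb{Q}^l:\sum\theta_i=1\}$. Let $S_l$ be the group of permutations of $\{0,\dots,l-1\}$, generated by $s_1,\dots,s_{l-1}$ with $s_i$ the transposition of $i-1$ and $i$; it acts on $\mathbb{Q}^l$ by: $s_i\cdot\theta$ has entry $\theta_{i-1}+\theta_i$ in position $i-1$, $-\theta_i$ in position $i$, $\theta_i+\theta_{i+1}$ in position $i+1$, and is otherwise unchanged (indices mod $l$). Let $e_0,\dots,e_{l-1}$ be the standard basis of $\mathbb{Z}^l$, $R\subset\mathbb{Z}^l$ the lattice generated by $\alpha_i=-e_{i-1}+2e_i-e_{i+1}$ ($0\le i\le l-1$, indices mod $l$), and $\tilde{S}_l=R\rtimes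 S_l$, acting on $\mathbb{Q}^l_1$ with $R$ acting by translations. Let $\mathbb{Z}^l_0=\{\mathbf{r}\in\mathbb{Z}^l:\sum r_i=0\}$ and $\phi:\mathbb{Z}^l_0\to R$, $\phi(\mathbf{r})=\sum_{j}(r_{j-1}-r_j)e_j$ (indices mod $l$). Fix $w_\theta\in\tilde{S}_l$ such that $\boldsymbol{\epsilon}:=w_\theta\cdot\theta$ satisfies $0\le\varepsilon_i\le1$ for all $i$, and write $w_\theta=\phi(\mathbf{r})w$ with $\mathbf{r}=(r_0,\dots,r_{l-1})\in\mathbb{Z}^l_0$, $w\in S_l$. Let $J=\{j:\varepsilon_j=0\}$ (the type of $\theta$). Then $d\boldsymbol{\epsilon}\in\mathbb{Z}^l$. For $\mathbf{s}\in\mathbb{Z}^l$ with $s=\sum s_i$ and an $l$-multipartition $\boldsymbol{\lambda}$, $\tau_{\mathbf{s}}(\boldsymbol{\lambda})$ denotes the unique partition whose $s$-shifted $\beta$-number is the set $\chi(\beta^{s_0}(\lambda^{(0)}),\dots,\beta^{s_{l-1}}(\lambda^{(l-1)}))$ arranged in decreasing order. For $w\in S_l$, $w(\boldsymbol{\lambda})$ is the multipartition whose $p$-th component is $\lambda^{(w^{-1}(p))}$. *)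

(* Defs.v *)
From Stdlib Require Import Relation_Operators ClassicalEpsilon.
From HB Require Import structures.
From mathcomp Require Import all_boot all_order all_algebra.
Set Implicit Arguments. Unset Strict Implicit. Unset Printing Implicit Defensive.
Import Order.TTheory GRing.Theory Num.Theory.
Local Open Scope ring_scope.

(* A partition is a weakly decreasing list of positive naturals
   (lambda_1 >= lambda_2 >= ... > 0); lambda_i = nth 0 p (i-1). *)
Definition is_part (p : seq nat) : bool :=
  sorted geq p && all (fun x => 0 < x)%N p.

Definition is_multipart (l n : nat) (lam : nat -> seq nat) : Prop :=
  (forall i, (i < l)%N -> is_part (lam i)) /\ (\sum_(i < l) sumn (lam i))%N = n.

Definition contents (p : seq nat) : seq int :=
  flatten [seq [seq (b%:Z - a%:Z) | b <- iota 1 (nth 0%N p a.-1)] | a <- iota 1 (size p)].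

(* r-shifted beta-number, as a set: x = lambda_i + r + 1 - i for some i >= 1 *)
Definition in_beta (r : int) (p : seq nat) (x : int) : Prop :=
  exists i : nat, (1 <= i)%N /\ x = (nth 0%N p i.-1)%:Z + r + 1 - i%:Z.

Definition in_chi (l : nat) (s : nat -> int) (lam : nat -> seq nat) (x : int) : Prop :=
  exists (q : nat) (C : int), (q < l)%N /\ in_beta (s q) (lam q) C /\
    x = l%:Z * (C - 1) + q%:Z + 1.

(* tau_s(lam): THE partition whose (sum s)-shifted beta-number is chi(...)
   (a strictly decreasing sequence is determined by its set of entries). *)
Definition tau (l : nat) (s : nat -> int) (lam : nat -> seq nat) : seq nat :=
  epsilon (inhabits [::]) (fun nu => is_part nu /\
     forall x, in_beta (\sum_(q < l) s q) nu x <-> in_chi l s lam x).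

Definition removable (p : seq nat) (k : nat) : bool :=
  (k < size p)%N && (nth 0%N p k.+1 < nth 0%N p k)%N.

Definition row_end_content (p : seq nat) (k : nat) : int :=
  (nth 0%N p k)%:Z - k.+1%:Z.

Definition remove_row (p : seq nat) (k : nat) : seq nat :=
  if nth 0%N p k == 1%N then take k p else set_nth 0%N p k (nth 0%N p k).-1.

Definition Jstep (l : nat) (J : nat -> bool) (p p' : seq nat) : Prop :=
  exists k, removable p k /\
    (exists j, J j /\ (l%:Z %| row_end_content p k - j%:Z)%Z) /\
    p' = remove_row p k.

Definition heart (l : nat) (J : nat -> bool) (p : seq nat) : seq nat :=
  epsilon (inhabits [::]) (fun h =>
    clos_refl_trans (seq nat) (Jstep l J) p h /\ ~ exists h', Jstep l J h h').

(* vectors in Q^l / Z^l are functions on positions 0..l-1 *)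
Definition theta (l : nat) (H : nat -> rat) (j : nat) : rat :=
  if j == 0%N then 1 + (- \sum_(1 <= i < l) H i) else H j.

(* alpha_i = -e_{i-1} + 2 e_i - e_{i+1} (indices mod l), at position p *)
Definition alpha (l i p : nat) : rat :=
  2%:R * ((p %% l == i %% l)%N)%:R - ((p %% l == (i + l).-1 %% l)%N)%:R
    - ((p %% l == i.+1 %% l)%N)%:R.

Definition gen_act (l i : nat) (th : nat -> rat) : nat -> rat :=
  fun p => th p - th i * alpha l i p.

Fixpoint word_act (l : nat) (ws : seq nat) (th : nat -> rat) : nat -> rat :=
  if ws is i :: ws' then gen_act l i (word_act l ws' th) else th.

Definition phi (l : nat) (r : nat -> int) (j : nat) : int :=
  r ((j + l).-1 %% l)%N - r j.

(* eps = w_theta . theta with w_theta = phi(r) w, w = s_{i1}...s_{ik} *)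
Definition eps (l : nat) (H : nat -> rat) (r : nat -> int) (ws : seq nat) (j : nat) : rat :=
  (phi l r j)%:~R + word_act l ws (theta l H) j.

Definition Jtype (l : nat) (H : nat -> rat) (r : nat -> int) (ws : seq nat) (j : nat) : bool :=
  (j < l)%N && (eps l H r ws j == 0).

Definition swap (i p : nat) : nat :=
  if p == i.-1 then i else if p == i then i.-1 else p.
Fixpoint word_perm (ws : seq nat) (p : nat) : nat :=
  if ws is i :: ws' then swap i (word_perm ws' p) else p.

(* w(lam) : p-th component is lam^(w^{-1}(p)); w^{-1} is the reversed word *)
Definition wmult (ws : seq nat) (lam : nat -> seq nat) : nat -> seq nat :=
  fun p => lam (word_perm (rev ws) p).

Definition mbar (d : nat) (H : nat -> rat) (i : nat) : rat :=
  d%:R * \sum_(1 <= j < i.+1) H j.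

Definition res_coef (l d : nat) (H : nat -> rat) (lam : nat -> seq nat) (k : int) : nat :=
  \sum_(i < l) count (fun c : int => (mbar d H i + d%:R * c%:~R == k%:~R)%R) (contents (lam i)).

(* Main.v *)
Require Import Defs.
From Stdlib Require Import Relation_Operators ClassicalEpsilon.
From HB Require Import structures.
From mathcomp Require Import all_boot all_order all_algebra.
From mathcomp Require Import zify ring.
Import Order.TTheory GRing.Theory Num.Theory.
Local Open Scope ring_scope.

(* Encode a partition by its beads y_k = lambda_(k+1) - (k+1), the contents of the ends
   of all its rows, including the empty ones.  With t_i = H_1 + ... + H_i and
   u_q = t_(w^-1(q)) - r_q, set g (l m + q) = u_q + m for 0 <= q < l.  Then
   g y - g (y - 1) = eps_(y mod l) >= 0, so removing a J-removable node moves a bead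
   one step down inside a level set of the monotone function g.  The J-heart is thus
   obtained by packing the beads at the bottom of each level set, and two J-hearts agree
   iff the numbers of beads on every level do.  The bead y of lambda^(i) becomes a bead
   of tau_r (w lambda) on the level t_i + y; telescoping along rows, the level counts
   minus those of the empty multipartition are A(v) - A(v + 1), where A(v) counts the
   nodes with t_i + content = v.  Since A vanishes far away, the level counts determine A,
   whose values are the coefficients in the residue identity. *)

(** * Beads of a partition *)

Lemma geq_trans : transitive geq.
Proof. by move=> y x z; lia. Qed.

Lemma part_nth_mono (p : seq nat) (i j : nat) :
  is_part p -> (i <= j)%N -> (nth 0%N p j <= nth 0%N p i)%N.
Proof.
case/andP=> sp _ le_ij.
have [jp|] := ltnP j (size p); last by move/(nth_default 0%N)->.
apply: (sorted_leq_nth geq_trans _ 0%N sp i j) => //; rewrite ?inE //; first by move=> x /=.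
exact: leq_ltn_trans jp.
Qed.

Lemma part_nth_gt0 (p : seq nat) (i : nat) :
  is_part p -> (0 < nth 0%N p i)%N = (i < size p)%N.
Proof.
case/andP=> _ pos; have [ip|/(nth_default 0%N)->//] := ltnP i (size p).
exact: (allP pos) (mem_nth _ ip).
Qed.

Lemma part_eq_nth (p q : seq nat) :
  is_part p -> is_part q -> nth 0%N p =1 nth 0%N q -> p = q.
Proof.
move=> pp pq eqn; have szE : size p = size q.
  apply/eqP; rewrite eqn_leq; apply/andP; split; rewrite leqNgt.
    by rewrite -(part_nth_gt0 _ _ pp) eqn part_nth_gt0 // ltnn.
  by rewrite -(part_nth_gt0 _ _ pq) -eqn part_nth_gt0 // ltnn.
by apply: (eq_from_nth (x0 := 0%N)) => // i _; exact: eqn.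
Qed.

(** A finite window on the infinite bead set: for [size p <= N] only the beads below [- N] are cut
    off, and these are all the integers there. *)
Definition beads (N : nat) (p : seq nat) : seq int := mkseq (row_end_content p) N.

Lemma row_end_content_decr (p : seq nat) (i j : nat) :
  is_part p -> (i < j)%N -> row_end_content p j < row_end_content p i.
Proof.
move=> pp ij; rewrite /row_end_content.
by have := part_nth_mono _ _ _ pp (ltnW ij); lia.
Qed.

Lemma row_end_content_inj (p : seq nat) : is_part p -> injective (row_end_content p).
Proof.
move=> pp i j; case: (ltngtP i j) => // /(row_end_content_decr _ _ _ pp); lia.
Qed.

Lemma beads_sorted (N : nat) (p : seq nat) :
  is_part p -> sorted (fun x y : int => y < x) (beads N p).
Proof.
move=> pp; apply/(sortedP 0) => i; rewrite size_mkseq => iN.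
by rewrite !nth_mkseq ?(ltnW iN) //; exact: row_end_content_decr.
Qed.

Lemma beads_uniq (N : nat) (p : seq nat) : is_part p -> uniq (beads N p).
Proof. by move=> pp; apply: mkseq_uniq; exact: row_end_content_inj. Qed.

Lemma beadsP (N : nat) (p : seq nat) (y : int) : (size p <= N)%N ->
  reflect (exists2 k, y = row_end_content p k & - N%:Z <= y) (y \in beads N p).
Proof.
move=> sN; apply: (iffP mapP) => [[k]|[k ->]].
  rewrite mem_iota => /andP[_ kN] ->; exists k => //.
  by rewrite /row_end_content; lia.
move=> ge; exists k => //; rewrite mem_iota /= add0n.
rewrite ltnNge; apply/negP => Nk.
by move: ge; rewrite /row_end_content nth_default ?(leq_trans sN) //; lia.
Qed.

Lemma row_end_content_below (p : seq nat) (N : nat) (y : int) : (size p <= N)%N ->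
  y < - N%:Z -> exists k, y = row_end_content p k.
Proof.
move=> sN yN; exists (absz y).-1.
by rewrite /row_end_content nth_default; lia.
Qed.

Lemma beads_inj (N : nat) (p q : seq nat) : is_part p -> is_part q ->
  (size p <= N)%N -> (size q <= N)%N -> beads N p =i beads N q -> p = q.
Proof.
move=> pp pq sp sq eqb.
have eb : beads N p = beads N q.
  apply: (@irr_sorted_eq _ (fun x y : int => y < x)) (beads_sorted _ _ pp)
           (beads_sorted _ _ pq) eqb.
    by move=> x y z /= ? ?; lia.
  by move=> x /=; rewrite ltxx.
apply: part_eq_nth => // k.
have [kN|Nk] := ltnP k N; last by rewrite !nth_default ?(leq_trans _ Nk).
have := congr1 (nth 0 ^~ k) eb; rewrite !nth_mkseq // /row_end_content; lia.
Qed.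

(** In a weakly decreasing list the zeros form the tail, where [nth] returns its default 0
    anyway. *)
Lemma nth_filter_gt0 (s : seq nat) (k : nat) : sorted geq s ->
  nth 0%N (filter (ltn 0) s) k = nth 0%N s k.
Proof.
elim: s k => [|a s IHs] k //= pas.
have ss := path_sorted pas.
case: a pas => [|a] pas /=; last by case: k => //= k; exact: IHs.
have s0 : all (pred1 0%N) s.
  apply/allP => x xs; have := allP (order_path_min geq_trans pas) x xs.
  by rewrite /= leqn0.
rewrite (@eq_in_filter _ _ pred0) ?filter_pred0; last first.
  by move=> x /(allP s0) /eqP ->.
rewrite nth_nil; case: k => //= k.
by have [ks|?] := ltnP k (size s); [rewrite (eqP (allP s0 _ (mem_nth 0%N ks)))|rewrite nth_default].
Qed.

(** The parts have to be [s_k + k + 1]: strict decrease of [s] makes them weakly decreasing, the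
    lower bound makes them nonnegative, and the trailing zeros are dropped. *)
Lemma beads_onto (s : seq int) :
  sorted (fun x y : int => y < x) s -> all (fun x => - (size s)%:Z <= x) s ->
  exists p, [/\ is_part p, (size p <= size s)%N & beads (size s) p = s].
Proof.
move=> ss bs; set N := size s in bs *.
pose m := mkseq (fun k => absz (nth 0 s k + k%:Z + 1)) N.
have step k : (k.+1 < N)%N -> nth 0 s k.+1 < nth 0 s k by exact: (sortedP 0 ss).
have ge k : (k < N)%N -> 0 <= nth 0 s k + k%:Z + 1.
  (* Induction from the last index downwards: the last entry is at least [- N], and each earlier one
     is larger by at least 1. *)
  have [j] := ubnP (N - k); elim: j k => // j IHj k jk kN.
  have [k1N|Nk1] := ltnP k.+1 N.
    by have := IHj k.+1 ltac:(lia) k1N; have := step k k1N; lia.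
  by have := allP bs (nth 0 s k) (mem_nth 0 kN); rewrite /=; lia.
have sm : sorted geq m.
  apply/(sortedP 0%N) => i; rewrite size_mkseq => iN /=.
  rewrite !nth_mkseq ?(ltnW iN) //.
  by have := ge _ iN; have := ge _ (ltnW iN); have := step _ iN; lia.
exists (filter (ltn 0) m); split.
- rewrite /is_part filter_all andbT.
  exact: (sorted_filter geq_trans).
- by rewrite size_filter (leq_trans (count_size _ _)) // size_mkseq.
apply: (eq_from_nth (x0 := 0)); rewrite size_mkseq // => k kN.
rewrite nth_mkseq // /row_end_content nth_filter_gt0 // nth_mkseq //.
by have := ge _ kN; lia.
Qed.

(** * Hearts and level sets *)

(** When row [k] has length 1, removability forces all later rows to be empty, so truncating the
    list at [k] changes only this row. *)
Lemma nth_remove_row (p : seq nat) (k j : nat) : is_part p -> removable p k ->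
  nth 0%N (remove_row p k) j = (nth 0%N p j - (j == k))%N.
Proof.
move=> pp /andP[kp lt1]; rewrite /remove_row.
case: eqP => [pk1|_]; last first.
  by rewrite nth_set_nth /=; case: eqP => [->|_]; lia.
have [jk|kj|->] := ltngtP j k; first by rewrite nth_take // subn0.
  rewrite nth_default ?size_take ?kp ?(ltnW kj) // subn0.
  by have := part_nth_mono _ _ _ pp kj; lia.
by rewrite nth_default ?size_take ?kp // pk1.
Qed.

Lemma remove_row_part (p : seq nat) (k : nat) :
  is_part p -> removable p k -> is_part (remove_row p k).
Proof.
move=> pp rk; have nthE := fun j => nth_remove_row p k j pp rk.
have [kp lt1] := andP rk.
apply/andP; split.
  apply/(sortedP 0%N) => i _ /=; rewrite !nthE.
  have := part_nth_mono _ _ _ pp (leqnSn i).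
  by case: (i =P k) => [->|]; lia.
apply/(all_nthP 0%N) => i; rewrite nthE /remove_row.
case: eqP => [pk1|pk1].
  rewrite size_take kp => ik.
  by have := part_nth_gt0 p i pp; lia.
rewrite size_set_nth (maxn_idPr kp) => ip.
by have := part_nth_gt0 p i pp; case: (i =P k) => [E|]; [subst i|]; lia.
Qed.

(** The termination measure behind the existence of hearts. *)
Lemma Jstep_sumn (l : nat) (J : nat -> bool) (p p' : seq nat) :
  is_part p -> Jstep l J p p' -> (sumn p' < sumn p)%N.
Proof.
move=> pp [k [/andP[kp lt1] [_ ->]]]; rewrite /remove_row.
have := part_nth_gt0 p k pp; rewrite kp => pk.
have -> : sumn p = (sumn (take k p) + (nth 0%N p k + sumn (drop k.+1 p)))%N.
  by rewrite -{1}(cat_take_drop k p) sumn_cat (drop_nth 0%N kp).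
case: eqP => _; first by lia.
by rewrite set_nthE kp sumn_cat /=; lia.
Qed.

Lemma Jstep_part (l : nat) (J : nat -> bool) (p p' : seq nat) :
  is_part p -> Jstep l J p p' -> is_part p'.
Proof. by move=> pp [k [rk [_ ->]]]; exact: remove_row_part. Qed.

Lemma heart_spec (l : nat) (J : nat -> bool) (p : seq nat) : is_part p ->
  clos_refl_trans (seq nat) (Jstep l J) p (heart l J p) /\
  ~ exists h, Jstep l J (heart l J p) h.
Proof.
move=> pp; apply: (epsilon_spec _ (fun h =>
  clos_refl_trans (seq nat) (Jstep l J) p h /\ ~ exists h', Jstep l J h h')).
have [m] := ubnP (sumn p); elim: m p pp => // m IHm p pp pm.
have [[p' st]|nst] := excluded_middle_informative (exists p', Jstep l J p p').
  have [|h [ph hn]] := IHm p' (Jstep_part _ _ _ _ pp st).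
    by have := Jstep_sumn _ _ _ _ pp st; lia.
  by exists h; split=> //; apply: rt_trans ph; exact: rt_step.
by exists p; split=> //; exact: rt_refl.
Qed.

Lemma Jsteps_part_size (l : nat) (J : nat -> bool) (p p' : seq nat) :
  clos_refl_trans (seq nat) (Jstep l J) p p' -> is_part p ->
  is_part p' /\ (size p' <= size p)%N.
Proof.
elim=> {p p'} [p p' [k [rk [_ ->]]] pp|p //|p q s _ IH1 _ IH2 pp].
  split; first exact: remove_row_part.
  have [kp _] := andP rk; rewrite /remove_row; case: eqP => _.
    by rewrite size_take; case: ifP => // _; exact: ltnW.
  by rewrite size_set_nth (maxn_idPr kp).
have [pq sq] := IH1 pp; have [ps ss] := IH2 pq.
by split=> //; exact: leq_trans sq.
Qed.

(* A J-step moves the bead y to y - 1, where g takes the same value. *)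
Lemma Jsteps_level (T : Type) (g : int -> T) (l : nat) (J : nat -> bool) (p p' : seq nat) :
  (forall y j, J j -> (l%:Z %| y - j%:Z)%Z -> g (y - 1) = g y) ->
  clos_refl_trans (seq nat) (Jstep l J) p p' -> is_part p ->
  forall k, g (row_end_content p' k) = g (row_end_content p k).
Proof.
move=> gJ; elim=> {p p'} [p p' [k [rk [[j [Jj lj]] ->]]] pp i|p //|].
  rewrite /row_end_content nth_remove_row //.
  case: (i =P k) => [->|_]; last by rewrite subn0.
  rewrite -(gJ _ _ Jj lj); congr g; rewrite /row_end_content.
  by have [kp _] := andP rk; have := part_nth_gt0 p k pp; lia.
move=> p q s pq IH1 _ IH2 pp k; rewrite -IH1 //; apply: IH2.
by have [] := Jsteps_part_size _ _ _ _ pq pp.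
Qed.

(** If [y] is the bead of row [k] and [y - 1] is not a bead, then row [k] ends in a removable node
    of content [y]; equal levels make it J-removable, which a heart forbids. *)
Lemma heart_beads_down (T : Type) (g : int -> T) (l : nat) (J : nat -> bool) (N : nat)
    (h : seq nat) :
  (forall y, g (y - 1) = g y -> exists2 j, J j & (l%:Z %| y - j%:Z)%Z) ->
  is_part h -> (size h <= N)%N -> ~ (exists h', Jstep l J h h') ->
  forall y, y \in beads N h -> g (y - 1) = g y -> - N%:Z <= y - 1 ->
  y - 1 \in beads N h.
Proof.
move=> gJ ph sN noJ y /(beadsP _ _ _ sN)[k -> _] gk ge.
apply/beadsP => //; exists k.+1 => //.
have [lt1|le1] := ltnP (nth 0%N h k.+1) (nth 0%N h k); last first.
  by have := part_nth_mono _ _ _ ph (leqnSn k); rewrite /row_end_content; lia.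
case: noJ; exists (remove_row h k), k; split.
  by rewrite /removable lt1 andbT -part_nth_gt0 //; lia.
by split=> //; have [j Jj lj] := gJ _ gk; exists j.
Qed.

Section LevelSets.
Variables (disp : Order.disp_t) (T : orderType disp) (g : int -> T).
Hypothesis g_mono : forall y, (g (y - 1) <= g y)%O.

Lemma level_mono : {homo g : x y / x <= y >-> (x <= y)%O}.
Proof.
move=> x y xy; have [m ->] : exists m : nat, y = x + m%:Z by exists (absz (y - x)); lia.
elim: m => [|m IHm]; first by rewrite addr0.
apply: le_trans IHm _; have := g_mono (x + m.+1%:Z).
by have -> : x + m.+1%:Z - 1 = x + m by lia.
Qed.

(** The packed shape of a heart: the level sets of the monotone [g] are intervals, and [s] fills
    each from its bottom, or from [b] if that is higher. *)
Definition down_closed (b : int) (s : seq int) :=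
  forall y, y \in s -> g (y - 1) = g y -> b <= y - 1 -> y - 1 \in s.

Lemma down_closed_level (b : int) (s : seq int) (x y : int) : down_closed b s ->
  y \in s -> b <= x -> x <= y -> g x = g y -> x \in s.
Proof.
move=> ds ys bx xy gxy.
have [m ym] : exists m : nat, x = y - m%:Z by exists (absz (y - x)); lia.
elim: m x ym bx xy gxy => [|m IHm] x ym bx xy gxy; first by rewrite ym subr0.
(* Monotonicity squeezes [g (x + 1)] between the equal values [g x] and [g y]. *)
have gx1 : g (x + 1) = g y.
  by apply/le_anti; rewrite level_mono -?gxy ?level_mono //; lia.
have := ds (x + 1); rewrite addrK; apply=> //; last by rewrite gx1.
by apply: IHm => //; lia.
Qed.

(** Suppose [x] is in [s] but not in [t]. Elements of [t] on the level of [x] must lie below [x],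
    hence belong to [s]; together with [x] this gives [s] more elements on that level than [t]. *)
Lemma down_closed_sub (b : int) (s t : seq int) : uniq t ->
  all (fun x => b <= x) s -> all (fun x => b <= x) t ->
  down_closed b s -> down_closed b t ->
  (forall v, count (fun y => g y == v) s = count (fun y => g y == v) t) ->
  {subset s <= t}.
Proof.
move=> ut bs bt ds dt eqc x xs; apply: contraT => xt.
have sub : {subset x :: filter (fun y => g y == g x) t <= filter (fun y => g y == g x) s}.
  move=> y; rewrite inE => /predU1P[->|]; rewrite !mem_filter ?eqxx //.
  case/andP=> /eqP gy yt; rewrite gy eqxx /=.
  apply: (down_closed_level _ _ _ _ ds xs) => //; first exact: (allP bt).
  rewrite leNgt; apply/negP => xy; case/negP: xt.
  by apply: (down_closed_level _ _ _ _ dt yt) => //; [exact: (allP bs)|lia].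
have /uniq_leq_size/(_ sub) : uniq (x :: filter (fun y => g y == g x) t).
  by rewrite /= filter_uniq // mem_filter (negbTE xt) andbF.
by rewrite /= !size_filter eqc ltnn.
Qed.

(** J-steps preserve level counts, and a packed bead set is determined by its level counts. *)
Lemma heart_eqP (l N : nat) (J : nat -> bool) (p q : seq nat) :
  (forall y, g (y - 1) = g y <-> exists2 j, J j & (l%:Z %| y - j%:Z)%Z) ->
  is_part p -> is_part q -> (size p <= N)%N -> (size q <= N)%N ->
  heart l J p = heart l J q <->
  (forall v, count (fun y => g y == v) (beads N p) = count (fun y => g y == v) (beads N q)).
Proof.
move=> gJ pp pq sp sq.
have gJ1 y j : J j -> (l%:Z %| y - j%:Z)%Z -> g (y - 1) = g y.
  by move=> Jj lj; apply/gJ; exists j.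
have gJ2 y : g (y - 1) = g y -> exists2 j, J j & (l%:Z %| y - j%:Z)%Z by move/gJ.
have heartE u v : is_part u ->
    count (fun y => g y == v) (beads N (heart l J u)) = count (fun y => g y == v) (beads N u).
  move=> pu; have [st _] := heart_spec l J _ pu.
  rewrite !count_map; apply: eq_count => k /=.
  by rewrite (Jsteps_level _ g _ _ _ _ gJ1 st pu).
split=> [eqh v|eqc]; first by rewrite -heartE // eqh heartE.
have geN u : is_part u -> (size u <= N)%N -> all (fun x => - N%:Z <= x) (beads N u).
  by move=> pu su; apply/allP => y /(beadsP _ _ _ su)[].
have [stp np] := heart_spec l J _ pp; have [stq nq] := heart_spec l J _ pq.
have [php shp] := Jsteps_part_size _ _ _ _ stp pp.
have [phq shq] := Jsteps_part_size _ _ _ _ stq pq.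
have shpN := leq_trans shp sp; have shqN := leq_trans shq sq.
have eqhc v : count (fun y => g y == v) (beads N (heart l J p))
            = count (fun y => g y == v) (beads N (heart l J q)) by rewrite !heartE.
apply: (beads_inj N) => // y; apply/idP/idP.
  apply: (down_closed_sub (- N%:Z)) => //; rewrite ?beads_uniq ?geN //;
    by apply: heart_beads_down gJ2 _ _ _.
apply: (down_closed_sub (- N%:Z)) => //; rewrite ?beads_uniq ?geN //;
  by apply: heart_beads_down gJ2 _ _ _.
Qed.

End LevelSets.

(** * The beads of tau *)

Lemma in_betaE (r : int) (p : seq nat) (x : int) :
  in_beta r p x <-> exists k, x = row_end_content p k + r + 1.
Proof.
split=> [[i [i1 ->]]|[k ->]]; [exists i.-1|exists k.+1]; rewrite /row_end_content /=.
  by case: i i1 => // i _ /=; lia.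
by split=> //; lia.
Qed.

(** The bead [y] of component [q] has beta-number [y + r q + 1], which [in_chi] sends to
    [l (y + r q) + q + 1], the bead [l (y + r q) + q] at total charge 0. The window of component [q]
    has size [M + r q] so that all components are cut at the same height [- M] after the shift. *)
Definition tau_beads (l : nat) (r : nat -> int) (lam : nat -> seq nat) (M : nat) : seq int :=
  flatten [seq [seq l%:Z * (y + r q) + q%:Z | y <- beads (absz (M%:Z + r q)) (lam q)]
          | q <- iota 0 l].

Lemma count_tau_beads (l : nat) (r : nat -> int) (lam : nat -> seq nat) (M : nat) (P : pred int) :
  count P (tau_beads l r lam M) = (\sum_(q < l)
    count (fun y => P (l%:Z * (y + r q) + q%:Z)%R) (beads (absz (M%:Z + r q)%R) (lam q)))%N.
Proof.
rewrite /tau_beads count_flatten -map_comp sumnE big_map -[l in iota 0 l]subn0.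
rewrite -/(index_iota 0 l) big_mkord; apply: eq_bigr => q _.
by rewrite /= count_map.
Qed.

Section Tau.
Variables (l : nat) (r : nat -> int) (lam : nat -> seq nat).
Hypothesis l_gt0 : (0 < l)%N.
Hypothesis r0 : \sum_(q < l) r q = 0.
Hypothesis lam_part : forall q, (q < l)%N -> is_part (lam q).

Lemma mulD_inj (a b : int) (p q : nat) : (p < l)%N -> (q < l)%N ->
  l%:Z * a + p%:Z = l%:Z * b + q%:Z -> a = b /\ p = q.
Proof.
move=> pl ql E; have ab : a = b by case: (ltgtP a b) => // ab; nia.
by split=> //; move: E; rewrite ab; lia.
Qed.

Lemma in_chiE (x : int) : in_chi l r lam x <-> exists q k,
  (q < l)%N /\ x = l%:Z * (row_end_content (lam q) k + r q) + q%:Z + 1.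
Proof.
split=> [[q [C [ql [/in_betaE[k ->] ->]]]]|[q [k [ql ->]]]].
  by exists q, k; split=> //; lia.
exists q, (row_end_content (lam q) k + r q + 1); split=> //; split; last lia.
by apply/in_betaE; exists k.
Qed.

(** Makes [M + r q] nonnegative, so that [absz] is harmless, and lets each window contain all
    nonempty rows. *)
Definition large (M : nat) :=
  forall q, (q < l)%N -> ((size (lam q))%:Z <= M%:Z + r q).

Lemma tau_beadsP (M : nat) (y : int) : large M ->
  reflect (- (l * M)%N%:Z <= y /\ in_chi l r lam (y + 1)) (y \in tau_beads l r lam M).
Proof.
move=> lM; apply: (iffP flatten_mapP) => [[q]|[ge /in_chiE[q [k [ql /addIr yE]]]]].
  rewrite mem_iota add0n => /= ql /mapP[z].
  have sM : (size (lam q) <= absz (M%:Z + r q)%R)%N by have := lM q ql; lia.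
  case/(beadsP _ _ _ sM) => k -> ge ->; split; last by apply/in_chiE; exists q, k.
  have : - M%:Z <= row_end_content (lam q) k + r q by have := lM q ql; lia.
  by nia.
exists q; first by rewrite mem_iota.
apply/mapP; exists (row_end_content (lam q) k) => //.
have sM : (size (lam q) <= absz (M%:Z + r q)%R)%N by have := lM q ql; lia.
apply/beadsP => //; exists k => //.
have : - M%:Z <= row_end_content (lam q) k + r q by nia.
by lia.
Qed.

Lemma tau_beads_uniq (M : nat) : uniq (tau_beads l r lam M).
Proof.
apply: allpairs_uniq_dep => [|q|].
- exact: iota_uniq.
- by rewrite mem_iota => /= ql; exact: beads_uniq (lam_part _ ql).
move=> _ _ /allpairsPdep[p [y [pl _ ->]]] /allpairsPdep[q [z [ql _ ->]]] /= E.
rewrite !mem_iota in pl ql.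
have [yz pq] := mulD_inj _ _ _ _ pl ql E; subst q.
by have -> : y = z by lia.
Qed.

(** The window sizes [M + r q] add up to [l M] because the charges sum to zero; hence [l M] rows of
    [tau] match this window. *)
Lemma size_tau_beads (M : nat) : large M -> size (tau_beads l r lam M) = (l * M)%N.
Proof.
move=> lM; rewrite -count_predT count_tau_beads.
under eq_bigr => q _ do rewrite (count_predT (beads _ _)) size_mkseq.
apply/eqP; rewrite -(eqr_nat int) natr_sum.
rewrite (eq_bigr (fun q : 'I_l => M%:Z + r q)) => [|q _].
  by rewrite big_split /= r0 addr0 sumr_const card_ord; apply/eqP; lia.
by have := lM q (ltn_ord q); lia.
Qed.

Lemma largeD (M k : nat) : large M -> large (M + k).
Proof. by move=> lM q /lM; lia. Qed.

Lemma large_ex : exists M, large M.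
Proof.
exists (\sum_(q < l) (size (lam q) + absz (r q)))%N => q ql.
by rewrite (bigD1 (Ordinal ql)) //=; lia.
Qed.

Lemma tau_ex : exists nu, is_part nu /\
  forall x, in_beta (\sum_(q < l) r q) nu x <-> in_chi l r lam x.
Proof.
have [M lM] := large_ex; rewrite r0.
(* Inside the window the sorted list is realised by [beads_onto]; below it both sets contain every
   integer. *)
pose s := sort (fun x y : int => y <= x) (tau_beads l r lam M).
have memE : s =i tau_beads l r lam M by apply: mem_sort.
have sE : size s = (l * M)%N by rewrite size_sort size_tau_beads.
have [||nu [pn sn bE]] := beads_onto s.
- have us : uniq s by rewrite sort_uniq tau_beads_uniq.
  have : sorted (fun x y : int => y <= x) s by apply: sort_sorted => x y; exact: le_total.
  move=> so; apply/(sortedP 0) => i iN.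
  have := sortedP 0 so i iN; rewrite le_eqVlt => /predU1P[E|//].
  by have := nth_uniq 0 iN (ltnW iN) us; rewrite E eqxx; lia.
- by apply/allP => y; rewrite memE sE => /tau_beadsP-/(_ lM)[].
rewrite sE in sn bE; exists nu; split=> // x.
have [ge|lt] := leP (- (l * M)%N%:Z) (x - 1).
  have := memE (x - 1); rewrite -bE => mE.
  split=> [/in_betaE[k xE]|xc].
    have : x - 1 \in beads (l * M) nu by apply/beadsP => //; exists k => //; lia.
    by rewrite mE => /tau_beadsP-/(_ lM)[_]; rewrite subrK.
  have : x - 1 \in tau_beads l r lam M by apply/tau_beadsP; rewrite ?subrK.
  rewrite -mE => /(beadsP _ _ _ sn)[k xE _]; apply/in_betaE; exists k; lia.
split=> _.
  (* Division of [x - 1] by [l] names the component (remainder) and the shifted bead (quotient),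
     which lies below that component's window. *)
  apply/in_chiE; have qE := divz_eq (x - 1) l%:Z.
  have q0 : 0 <= ((x - 1) %% l%:Z)%Z by apply: modz_ge0; lia.
  have ql : ((x - 1) %% l%:Z)%Z < l%:Z by apply: ltz_pmod; lia.
  set m := ((x - 1) %/ l%:Z)%Z in qE; set q := ((x - 1) %% l%:Z)%Z in qE q0 ql.
  have mM : m < - M%:Z by nia.
  have := lM (absz q) ltac:(lia) => sM.
  have [|k kE] := row_end_content_below (lam (absz q)) _ (m - r (absz q)) (leqnn _).
    by lia.
  by exists (absz q), k; split; [lia|rewrite -kE; nia].
apply/in_betaE; have [k kE] := row_end_content_below _ _ _ sn lt.
by exists k; lia.
Qed.

Lemma tau_part : is_part (tau l r lam).
Proof. by have [] := epsilon_spec (inhabits [::]) _ tau_ex. Qed.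

(** Holding for every large [M], it lets two multipartitions share one window. *)
Lemma tau_perm_beads : exists M0, forall M, (M0 <= M)%N ->
  [/\ forall q, (q < l)%N -> (size (lam q) <= absz (M%:Z + r q)%R)%N,
     (size (tau l r lam) <= l * M)%N &
     perm_eq (beads (l * M) (tau l r lam)) (tau_beads l r lam M)].
Proof.
have [M0 lM0] := large_ex.
have [pt] := epsilon_spec (inhabits [::]) _ tau_ex; rewrite -/(tau l r lam) r0 => tE.
exists (M0 + size (tau l r lam))%N => M leM.
have lM : large M by rewrite -(subnKC leM) -addnA; exact: largeD.
have st : (size (tau l r lam) <= l * M)%N by nia.
split=> //; first by move=> q /lM; lia.
apply: uniq_perm; rewrite ?tau_beads_uniq ?beads_uniq // => y.
apply/(beadsP _ _ _ st)/tau_beadsP => // [[k yE ge]|[ge /tE/in_betaE[k yE]]].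
  by split=> //; apply/tE/in_betaE; exists k; lia.
by exists k => //; lia.
Qed.

End Tau.

(** * Residues *)

Definition row_contents (k m : nat) : seq int := [seq b%:Z - k.+1%:Z | b <- iota 1 m].

(** The contents of a row form an integer interval; shifting it down by one loses the top
    [m - k - 1] and gains [- k - 1]. *)
Lemma count_row_contents (P : pred int) (k m : nat) :
  (P (m%:Z - k.+1%:Z)%R + count (fun c : int => P (c - 1)%R) (row_contents k m) =
   P (- k.+1%:Z)%R + count P (row_contents k m))%N.
Proof.
rewrite /row_contents; elim: m => [|m IHm]; first by rewrite sub0r.
have -> : iota 1 m.+1 = iota 1 m ++ [:: m.+1] by rewrite -[m.+1 in LHS]addn1 iotaD.
rewrite !map_cat !count_cat /= !addn0.
have -> : m.+1%:Z - k.+1%:Z - 1 = m%:Z - k.+1%:Z by lia.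
by rewrite addnC [(count _ _ + P _)%N]addnC IHm -addnA.
Qed.

Lemma count_contents (P : pred int) (N : nat) (p : seq nat) : (size p <= N)%N ->
  count P (contents p) = (\sum_(k < N) count P (row_contents k (nth 0 p k)))%N.
Proof.
move=> sN; rewrite /contents count_flatten -map_comp sumnE big_map.
rewrite (iotaDl 1 0) big_map -{1}[size p]subn0 -/(index_iota 0 (size p)).
rewrite -(big_mkord xpredT (fun k => count P (row_contents k (nth 0%N p k)))).
rewrite (big_cat_nat _ sN) //= [X in (_ + X)%N]big1_seq ?addn0 // => k.
by rewrite mem_index_iota => /andP[_ /andP[sk _]]; rewrite nth_default.
Qed.

Lemma count_beads (P : pred int) (N : nat) (p : seq nat) :
  count P (beads N p) = (\sum_(k < N) P (row_end_content p k))%N.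
Proof.
rewrite -sum1_count big_map big_mkcond -[N in iota 0 N]subn0 -/(index_iota 0 N) big_mkord.
by apply: eq_bigr => k _; case: (P _).
Qed.

(* Each row telescopes: its last content minus the vacuum bead -k-1. *)
Lemma count_beads_contents (P : pred int) (N : nat) (p : seq nat) : (size p <= N)%N ->
  (count P (beads N p) + count (fun c : int => P (c - 1)%R) (contents p) =
   count P (beads N [::]) + count P (contents p))%N.
Proof.
move=> sN; rewrite !count_beads !(count_contents _ _ _ sN) -!big_split /=.
apply: eq_bigr => k _; have := count_row_contents P k (nth 0%N p k).
by rewrite /row_end_content nth_nil sub0r.
Qed.

Lemma seq_int_ubound (s : seq int) : exists b : nat, forall c, c \in s -> c < b%:Z.
Proof.
elim: s => [|a s [b bP]]; first by exists 0%N.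
exists (b + (absz a).+1)%N => c; rewrite inE => /predU1P[->|/bP]; lia.
Qed.

(** The coefficient of [x^v] in the sum over [q < l] of [x^(t q)] times the sum of [x^c] for [c] in
    [s q], with rational exponents. *)
Definition charged_count (l : nat) (t : nat -> rat) (s : nat -> seq int) (v : rat) : nat :=
  (\sum_(q < l) count (fun c : int => t q + c%:~R == v)%R (s q))%N.

Lemma charged_count_ubound (l : nat) (t : nat -> rat) (s : nat -> seq int) (v : rat) :
  exists m0 : nat, forall m : nat, (m0 <= m)%N -> charged_count l t s (v + m%:R) = 0%N.
Proof.
have [m0 m0P] : exists m0 : nat, forall q, (q < l)%N -> forall m : nat, (m0 <= m)%N ->
    count (fun c : int => t q + c%:~R == v + m%:R) (s q) = 0%N.
  elim: l => [|l [m1 m1P]]; first by exists 0%N.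
  have [b bP] := seq_int_ubound (s l).
  pose z := Num.trunc `|t l - v|.
  exists (m1 + (b + z.+1))%N => q; rewrite ltnS leq_eqVlt => /predU1P[->|ql] m mle; last first.
    by apply: m1P => //; lia.
  apply/eqP; rewrite eqn0Ngt -has_count; apply/hasPn => c cs.
  apply/eqP => E.
  have zP : `|t l - v| < z.+1%:R by exact: truncnS_gt.
  have : t l - v < z.+1%:R by apply: le_lt_trans zP; exact: ler_norm.
  (* A hit would give [m - c < z + 1] with [c < b], impossible for [m] past [b + z + 1]. *)
  have -> : t l - v = (m%:Z - c)%:~R by rewrite intrB -[in LHS](addrK c%:~R (t l)) E /=; ring.
  by rewrite -[z.+1%:R]/((z.+1)%:Z%:~R) ltr_int; have := bP c cs; lia.
by exists m0 => m mm; apply: big1 => q _; exact: m0P.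
Qed.

Lemma charged_beads_contents (l : nat) (t : nat -> rat) (N : nat -> nat)
    (lam mu : nat -> seq nat) :
  (forall q, (q < l)%N -> (size (lam q) <= N q)%N) ->
  (forall q, (q < l)%N -> (size (mu q) <= N q)%N) ->
  (forall v, charged_count l t (fun q => beads (N q) (lam q)) v =
             charged_count l t (fun q => beads (N q) (mu q)) v) <->
  (forall v, charged_count l t (fun q => contents (lam q)) v =
             charged_count l t (fun q => contents (mu q)) v).
Proof.
(* The telescoped rows, summed over all components; the shift [c - 1] of a content turns level [v]
   into [v + 1]. *)
have key (nu : nat -> seq nat) v : (forall q, (q < l)%N -> (size (nu q) <= N q)%N) ->
    (charged_count l t (fun q => beads (N q) (nu q)) v
     + charged_count l t (fun q => contents (nu q)) (v + 1)%R =
     charged_count l t (fun q => beads (N q) [::]) v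
     + charged_count l t (fun q => contents (nu q)) v)%N.
  move=> sN; rewrite /charged_count -!big_split; apply: eq_bigr => q _ /=.
  rewrite -(count_beads_contents (fun c : int => t q + c%:~R == v)) ?sN //; congr addn.
  by apply: eq_count => c /=; rewrite intrB addrA subr_eq.
move=> sl sm; split=> eqv v; last first.
  by have := key lam v sl; have := key mu v sm; rewrite !eqv; lia.
have [m1 m1P] := charged_count_ubound l t (fun q => contents (lam q)) v.
have [m2 m2P] := charged_count_ubound l t (fun q => contents (mu q)) v.
(* Both content counts vanish here; [key] then carries their equality down from [v + m + 1] to
   [v + m] until [v] is reached. *)
have end0 : charged_count l t (fun q => contents (lam q)) (v + (m1 + m2)%:R) =
    charged_count l t (fun q => contents (mu q)) (v + (m1 + m2)%:R).
  by rewrite m1P ?m2P // ?leq_addl ?leq_addr.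
elim: (m1 + m2)%N end0 => [|m IHm] Em; first by rewrite addr0 in Em.
apply: IHm; have := key lam (v + m%:R) sl; have := key mu (v + m%:R) sm.
have -> : v + m%:R + 1 = v + m.+1%:R by rewrite -natr1 addrA.
by rewrite Em eqv => -> /addnI.
Qed.

(** * The level function *)

Lemma swapK (i : nat) : involutive (swap i).
Proof. by move=> p; rewrite /swap; do !case: eqP => //; lia. Qed.

Lemma swap_lt (l i p : nat) : (0 < i < l)%N -> (p < l)%N -> (swap i p < l)%N.
Proof. by rewrite /swap; do !case: eqP => //; lia. Qed.

Lemma word_perm_lt (l : nat) (ws : seq nat) (p : nat) :
  all (fun i => (0 < i < l)%N) ws -> (p < l)%N -> (word_perm ws p < l)%N.
Proof. by elim: ws => //= i ws IHws /andP[il /IHws ws_l] /ws_l; exact: swap_lt. Qed.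

Lemma word_perm_rcons (ws : seq nat) (i p : nat) :
  word_perm (rcons ws i) p = word_perm ws (swap i p).
Proof. by elim: ws => //= j ws ->. Qed.

Lemma sum_word_perm (l : nat) (ws : seq nat) (F : nat -> nat) :
  all (fun i => (0 < i < l)%N) ws ->
  (\sum_(q < l) F (word_perm ws q) = \sum_(q < l) F q)%N.
Proof.
elim: ws F => //= i ws IHws F /andP[il wsl].
rewrite (IHws (F \o swap i) wsl) -(big_mkord xpredT F) -(big_mkord xpredT (F \o swap i)).
rewrite -[LHS](big_map (swap i) xpredT F); apply/perm_big/uniq_perm => [||p].
- by rewrite map_inj_uniq ?iota_uniq //; exact: inv_inj (swapK i).
- exact: iota_uniq.
rewrite mem_index_iota /=; apply/mapP/idP => [[q]|pl].
  by rewrite mem_index_iota /= => ql ->; exact: swap_lt.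
by exists (swap i p); rewrite ?swapK // mem_index_iota swap_lt.
Qed.

(** Successive differences of [T] extended by [T (p + l) = T p + 1]. These coordinates on vectors of
    sum 1 turn the reflections into permutations of [T]. *)
Definition cyclic_diff (l : nat) (T : nat -> rat) (p : nat) : rat :=
  T p - (if p == 0%N then T l.-1 - 1 else T p.-1).

(** Negating the difference at [i] and adding it to both neighbours exchanges [T (i - 1)] and [T i].
    The cases track where neighbours wrap round modulo [l]. *)
Lemma gen_act_cyclic_diff (l i p : nat) (T th : nat -> rat) :
  (0 < i < l)%N -> (p < l)%N -> (forall q, (q < l)%N -> th q = cyclic_diff l T q) ->
  gen_act l i th p = cyclic_diff l (T \o swap i) p.
Proof.
move=> il pl thE; rewrite /gen_act !thE //; last by lia.
rewrite /alpha (modn_small pl) (@modn_small i) ?(@modn_small l.-1); try lia.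
have -> : ((i + l).-1 %% l = i.-1)%N.
  have -> : (i + l).-1 = (i.-1 + l)%N by lia.
  by rewrite modnDr modn_small //; lia.
have jE : (i.+1 %% l)%N = if i.+1 == l then 0%N else i.+1.
  by case: eqP => [->|]; rewrite ?modnn // => ?; rewrite modn_small //; lia.
move: (i.+1 %% l)%N jE => j jE.
have swapi : swap i i = i.-1 by rewrite /swap eqxx; case: eqP => //; lia.
have swapi1 : swap i i.-1 = i by rewrite /swap eqxx.
have swapx q : q != i -> q != i.-1 -> swap i q = q by rewrite /swap => /negbTE -> /negbTE ->.
have i0 : (i == 0%N) = false by lia.
rewrite /cyclic_diff /= i0.
have [->|pi] := eqVneq p i.
  have -> : (i == i.-1) = false by lia.
  have -> : (i == j) = false by move: jE; case: ifP; lia.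
  by rewrite i0 swapi swapi1 /=; ring.
have [->|pi1] := eqVneq p i.-1.
  rewrite swapi1; have [i1|i1] := eqVneq i.-1 0%N.
    have [il1|il1] := eqVneq i.+1 l.
      (* Here [l = 2]: both neighbours of [i] are position 0, which receives the difference
         twice. *)
      have -> : l.-1 = i by lia.
      have -> : (i.-1 == j) by rewrite jE il1 eqxx i1.
      by rewrite i1 swapi i1 /=; ring.
    have -> : (i.-1 == j) = false by rewrite jE (negbTE il1); lia.
    by rewrite i1 swapx; [rewrite /=; ring|lia|lia].
  have -> : (i.-1 == j) = false by move: jE; case: ifP; lia.
  by rewrite swapx; [rewrite /=; ring|lia|lia].
rewrite (swapx p) //; have [p0|p0] := eqVneq p 0%N.
  rewrite p0; have [il1|il1] := eqVneq i.+1 l.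
    have -> : l.-1 = i by lia.
    have -> : (0%N == j) by rewrite jE il1 eqxx.
    by rewrite swapi /=; ring.
  have -> : (0%N == j) = false by rewrite jE (negbTE il1).
  by rewrite swapx; [rewrite /=; ring|lia|lia].
have [pi2|pi2] := eqVneq p i.+1.
  have -> : (p == j) by move: jE; case: ifP; lia.
  by rewrite pi2 /= swapi; ring.
have -> : (p == j) = false by move: jE; case: ifP; lia.
by rewrite swapx; [rewrite /=; ring|lia|lia].
Qed.

(** [theta] is the cyclic difference of the partial sums of [H], and each letter precomposes with a
    swap, so the word acts through the inverse permutation. *)
Lemma word_act_theta (l : nat) (H : nat -> rat) (ws : seq nat) (p : nat) :
  (0 < l)%N -> all (fun i => (0 < i < l)%N) ws -> (p < l)%N ->
  word_act l ws (theta l H) p =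
  cyclic_diff l (fun q => \sum_(1 <= j < (word_perm (rev ws) q).+1) H j) p.
Proof.
move=> l0; elim: ws p => [|i ws IHws] p /=; last first.
  case/andP=> il wsl pl.
  rewrite (gen_act_cyclic_diff _ _ _ _ _ il pl (fun q => IHws q wsl)).
  rewrite /cyclic_diff /=; case: eqP => _; by rewrite rev_cons !word_perm_rcons.
move=> _ pl; rewrite /theta /cyclic_diff /=; case: p pl => [|p] pl /=.
  by rewrite [X in _ = X - _]big_geq // prednK //; ring.
by rewrite [in RHS]big_nat_recr //= addrC addrK.
Qed.

(** The extension of [u] from [0..l-1] to all integers with [level (y + l) = level y + 1]. *)
Definition level (l : nat) (u : nat -> rat) (y : int) : rat :=
  u (absz (y %% l%:Z)%Z) + (y %/ l%:Z)%Z%:~R.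

Lemma levelE (l : nat) (u : nat -> rat) (m : int) (q : nat) : (q < l)%N ->
  level l u (l%:Z * m + q%:Z) = u q + m%:~R.
Proof.
move=> ql; rewrite /level mulrC modzMDl divzMDl; last by lia.
by rewrite modz_small ?divz_small ?addr0 //; lia.
Qed.

Lemma level_step (l : nat) (u : nat -> rat) (y : int) : (0 < l)%N ->
  level l u y - level l u (y - 1) = cyclic_diff l u (absz (y %% l%:Z)%Z).
Proof.
move=> l0; have q0 : 0 <= (y %% l%:Z)%Z by apply: modz_ge0; lia.
have ql : (y %% l%:Z)%Z < l%:Z by apply: ltz_pmod; lia.
have := divz_eq y l%:Z; set m := (y %/ _)%Z; set q := absz _ => yE.
have {}yE : y = l%:Z * m + q%:Z by lia.
have {q0}ql : (q < l)%N by lia.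
rewrite {1}yE levelE // /cyclic_diff; case: eqP => [q0|q0].
  (* At remainder 0 the predecessor lies in the previous block, whence the [- 1] in
     [cyclic_diff]. *)
  have -> : y - 1 = l%:Z * (m - 1) + l.-1%:Z by nia.
  by rewrite levelE ?prednK // intrB; ring.
have -> : y - 1 = l%:Z * m + q.-1%:Z by lia.
by rewrite levelE ?(leq_ltn_trans (leq_pred _)) //; ring.
Qed.

(** * Coefficients of the residue identity *)

Lemma res_coefE (l d : nat) (H : nat -> rat) (lam : nat -> seq nat) (k : int) : (0 < d)%N ->
  res_coef l d H lam k = charged_count l (fun i => \sum_(1 <= j < i.+1) H j)
    (fun i => contents (lam i)) (k%:~R / d%:R).
Proof.
move=> d0; apply: eq_bigr => i _; apply: eq_count => c /=.
have dn0 : d%:R != 0 :> rat by rewrite pnatr_eq0 -lt0n.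
by rewrite /mbar -mulrDr -[RHS](inj_eq (mulfI dn0)) [_ * (_ / _)]mulrC divfK.
Qed.

Lemma res_coef_eqP (l d : nat) (H : nat -> rat) (lam mu : nat -> seq nat) : (0 < d)%N ->
  (forall i, (1 <= i < l)%N -> d%:R * H i \is a Num.int) ->
  (forall v, charged_count l (fun i => \sum_(1 <= j < i.+1) H j) (fun i => contents (lam i)) v =
             charged_count l (fun i => \sum_(1 <= j < i.+1) H j) (fun i => contents (mu i)) v) <->
  (forall k, res_coef l d H lam k = res_coef l d H mu k).
Proof.
move=> d0 dH; have dn0 : d%:R != 0 :> rat by rewrite pnatr_eq0 -lt0n.
split=> [eqv k|eqk v]; first by rewrite !res_coefE.
(* Integrality of the [d H_i] puts every node on a level [v] with [d v] an integer; on all other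
   levels both counts are zero. *)
have [/intrP[k vk]|vZ] := boolP (d%:R * v \is a Num.int).
  have -> : v = k%:~R / d%:R by rewrite -vk mulrC mulKf.
  by rewrite -!res_coefE.
have nil nu : charged_count l (fun i => \sum_(1 <= j < i.+1) H j) (fun i => contents (nu i)) v = 0%N.
  apply: big1 => i _; apply/eqP; rewrite eqn0Ngt -has_count; apply/hasPn => c _.
  apply: contraNN vZ => /eqP <-; rewrite mulrDr rpredD //; last by rewrite rpredM ?natr_int ?intr_int.
  rewrite mulr_sumr big_seq rpred_sum // => j.
  by rewrite mem_index_iota => /andP[j1 ji]; apply: dH; rewrite j1 /= (leq_trans ji).
by rewrite !nil.
Qed.

(** * Levels for the given parameters and the final equivalence *)

Lemma eps_cyclic_diff (l : nat) (H : nat -> rat) (r : nat -> int) (ws : seq nat) (p : nat) :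
  (0 < l)%N -> all (fun i => (0 < i < l)%N) ws -> (p < l)%N ->
  eps l H r ws p =
  cyclic_diff l
    (fun q => \sum_(1 <= j < (word_perm (rev ws) q).+1) H j - (r q)%:~R) p.
Proof.
move=> l0 wsl pl; rewrite /eps word_act_theta // /cyclic_diff /phi.
(* The translation [phi l r] is the cyclic difference of [- r] without the wrap-around jump, so it
   subtracts [r] from the coordinates. *)
case: p pl => [|p] pl /=.
  by rewrite add0n modn_small ?intrB; [ring|lia].
by rewrite modnDr modn_small ?intrB; [ring|lia].
Qed.

Lemma level_fixP (l : nat) (H : nat -> rat) (r : nat -> int) (ws : seq nat) (u : nat -> rat)
    (y : int) : (0 < l)%N -> (forall p, (p < l)%N -> eps l H r ws p = cyclic_diff l u p) ->
  level l u (y - 1) = level l u y <->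
  exists2 j, Jtype l H r ws j & (l%:Z %| y - j%:Z)%Z.
Proof.
move=> l0 epsE.
have q0 : 0 <= (y %% l%:Z)%Z by apply: modz_ge0; lia.
have ql : (y %% l%:Z)%Z < l%:Z by apply: ltz_pmod; lia.
have step := level_step l u y l0; split=> [gy|[j /andP[jl /eqP ej] /dvdzP[m yE]]].
  exists (absz (y %% l%:Z)%Z); last first.
    by rewrite gez0_abs // {1}(divz_eq y l%:Z) addrK dvdz_mull.
  by rewrite /Jtype epsE -?step ?gy ?subrr ?eqxx ?andbT //; lia.
have jE : absz (y %% l%:Z)%Z = j.
  by rewrite (_ : y = m * l%:Z + j%:Z) ?modzMDl ?modz_small //; lia.
by apply/eqP; rewrite eq_sym -subr_eq0 step jE -epsE // ej.
Qed.

(** The charge cancels: the bead [l (y + r q) + q] has level [T q - r q + (y + r q) = T q + y]. *)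
Lemma charged_tau_beads (l M : nat) (T : nat -> rat) (r : nat -> int) (lam : nat -> seq nat)
    (v : rat) :
  count (fun y => level l (fun q => T q - (r q)%:~R) y == v) (tau_beads l r lam M) =
  charged_count l T (fun q => beads (absz (M%:Z + r q)) (lam q)) v.
Proof.
rewrite count_tau_beads; apply: eq_bigr => q _; apply: eq_count => y /=.
by congr (_ == v); rewrite levelE // intrD; ring.
Qed.

Theorem theorem3p13 (l n d : nat) (H : nat -> rat) (r : nat -> int) (ws : seq nat)
    (lam mu : nat -> seq nat) :
  (0 < l)%N -> (0 < n)%N -> (0 < d)%N ->
  (forall i, (1 <= i < l)%N -> d%:R * H i \is a Num.int) ->
  \sum_(j < l) r j = 0 ->
  all (fun i => (0 < i < l)%N) ws ->
  (forall j, (j < l)%N -> 0 <= eps l H r ws j <= 1) ->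
  is_multipart l n lam -> is_multipart l n mu ->
  heart l (Jtype l H r ws) (tau l r (wmult ws lam))
    = heart l (Jtype l H r ws) (tau l r (wmult ws mu))
  <-> (forall k : int, res_coef l d H lam k = res_coef l d H mu k).
Proof.
move=> l0 _ d0 dH r0 wsl eps01 [plam _] [pmu _].
pose t i := \sum_(1 <= j < i.+1) H j.
pose T q := t (word_perm (rev ws) q).
pose u q := T q - (r q)%:~R.
have epsE p : (p < l)%N -> eps l H r ws p = cyclic_diff l u p.
  exact: eps_cyclic_diff.
have g_mono y : (level l u (y - 1) <= level l u y)%O.
  have ql : (y %% l%:Z)%Z < l%:Z by apply: ltz_pmod; lia.
  have q0 : 0 <= (y %% l%:Z)%Z by apply: modz_ge0; lia.
  have ql' : (absz (y %% l%:Z)%Z < l)%N by lia.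
  by rewrite -subr_ge0 level_step // -epsE //; case/andP: (eps01 _ ql').
have w_lt q : (q < l)%N -> (word_perm (rev ws) q < l)%N.
  by apply: word_perm_lt; rewrite all_rev.
have pwlam q : (q < l)%N -> is_part (wmult ws lam q) by move=> /w_lt; exact: plam.
have pwmu q : (q < l)%N -> is_part (wmult ws mu q) by move=> /w_lt; exact: pmu.
have [M1 M1P] := tau_perm_beads l r _ l0 r0 pwlam.
have [M2 M2P] := tau_perm_beads l r _ l0 r0 pwmu.
have [sl stl bl] := M1P _ (leq_maxl M1 M2).
have [sm stm bm] := M2P _ (leq_maxr M1 M2).
apply: (iff_trans (heart_eqP _ _ _ g_mono l _ _ _ _
  (fun y => level_fixP l H r ws u y l0 epsE) (tau_part _ _ _ l0 r0 pwlam)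
  (tau_part _ _ _ l0 r0 pwmu) stl stm)).
apply: iff_trans (res_coef_eqP l d H lam mu d0 dH).
(* Component [q] of [wmult ws nu] and the charge [T q] both come from index [w^-1(q)], so the sum is
   merely reindexed. *)
have wE nu v : charged_count l T (fun q => contents (wmult ws nu q)) v =
               charged_count l t (fun i => contents (nu i)) v.
  pose F i := count (fun c : int => t i + c%:~R == v) (contents (nu i)).
  by apply: (sum_word_perm l _ F); rewrite all_rev.
apply: iff_trans; last first.
  apply: iff_trans (charged_beads_contents l T _ _ _ sl sm) _.
  by split=> eqv v; have := eqv v; rewrite !wE.
by split=> eqv v; have := eqv v;
  rewrite (permP bl) (permP bm) !charged_tau_beads.
Qed.
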